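(* Let $A\in\mathbb{R}^{d\times d}$ be normal ($AA^\top=A^\top A$) with all eigenvalues having strictly negative real part. Let $0\le l'\le l$ be integers with $l'+2(l-l')=d$, such that, counted with multiplicity, $A$ has $l'$ real eigenvalues and $l-l'$ complex conjugate pairs of non-real eigenvalues. Let $f_1,\dots,f_l\in\mathbb{C}^d$ be unit left eigenvectors of $A$, $f_k^*A=-\lambda_k f_k^*$, where for $1\le k\le l'$ the number $\lambda_k>0$ is real and $f_k\in\mathbb{R}^d$, and for $l'+1\le k\le l$ one has $\lambda_k=a_k-ib_k$ with $a_k>0$ and $b_k\in\mathbb{R}\setminus\{0\}$ (one eigenvector for each complex conjugate pair), such that $f_1,\dots,f_{l'},f_{l'+1},\overline{f_{l'+1}},\dots,f_l,\overline{f_l}$ is an orthonormal basis of $\mathbb{C}^d$. Let $B\in\mathbb{R}^{d\times d}$ be symmetric with $Bf_k=\sigma_kf_k$, $\sigma_k>0$, for $k=1,\dots,l$. Let $Q=\frac12BB^\top$ and let $$\mathcal{A}\psi=\sum_{i=1}^d (Ax)_i\frac{\partial\psi}{\partial x_i}+\sum_{i,j=1}^dQ_{ij}\frac{\partial^2\psi}{\partial x_i\partial x_j}$$ be the associated Ornstein--Uhlenbeck operator, acting on complex-valued functions on $\mathbb{R}^d$. For every multi-index $\mathbf{n}=(n_1,\dots,n_{l'},n_{(l'+1)1},n_{(l'+1)2},\dots,n_{l1},n_{l2})\in\mathbb{N}_0^d$, the polynomial $$\phi_{\mathbf n}(x)=\prod_{k=1}^{l'}\mathrm{He}_{n_k}\!\left(\sqrt{\frac{2\lambda_k}{\sigma_k^2}}\,\langle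 x,f_k\rangle\right)\cdot\prod_{k=l'+1}^{l}J_{n_{k1},n_{k2}}\!\left(\sqrt2\,\langle x,f_k\rangle,\sqrt2\,\overline{\langle x,f_k\rangle};\rho_k\right),\qquad \rho_k=\frac{\sigma_k^2}{a_k},$$ is an eigenfunction of $\mathcal{A}$: $\mathcal{A}\phi_{\mathbf n}=\mu_{\mathbf n}\phi_{\mathbf n}$ with $$\mu_{\mathbf n}=\sum_{k=1}^{l'}-n_k\lambda_k-\sum_{k=l'+1}^{l}\left[(n_{k1}+n_{k2})a_k-i(n_{k1}-n_{k2})b_k\right].$$
   Context: $\langle u,v\rangle=u^*v$, where $^*$ is the conjugate transpose, so $\langle x,f\rangle=x^\top f$ for $x\in\mathbb{R}^d$. $\mathbb{N}_0$ is the set of nonnegative integers. $\mathrm{He}_n$ denotes the probabilists' Hermite polynomials: $\mathrm{He}_0=1$, $\mathrm{He}_1(x)=x$, $\mathrm{He}_{n+1}(x)=x\,\mathrm{He}_n(x)-n\,\mathrm{He}_{n-1}(x)$. They satisfy $-x\mathrm{He}_n'(x)+\mathrm{He}_n''(x)=-n\mathrm{He}_n(x)$. The Hermite--Laguerre--It\^o polynomials, for $m,n\in\mathbb{N}_0$, $\rho>0$, $z\in\mathbb{C}$, are $$J_{m,n}(z,\bar z;\rho)=\begin{cases}(-1)^n n!\,z^{m-n}L_n^{m-n}(z\bar z,\rho), & m\ge n,\\ (-1)^m m!\,\bar z^{\,n-m}L_m^{n-m}(z\bar z,\rho), & m<n,\end{cases}$$ where $L_n^\alpha(x,\rho)$ is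 the generalized Laguerre polynomial defined by $$L_n^\alpha(x,\rho)=\frac{\rho^n}{n!}x^{-\alpha}e^{x/\rho}\frac{d^n}{dx^n}\left(e^{-x/\rho}x^{n+\alpha}\right).$$
   Formalization: For the non-real eigenvectors (k>l') the coordinate in φ_n is taken as ⟨f_k,x⟩=f_k^*x instead of ⟨x,f_k⟩=x^⊤f_k; with the latter, the imaginary part of μ_n has the wrong sign and the claim fails (e.g. n=(1,0), d=2). *)

(* Defs.v *)
(* MathComp / MathComp-Analysis, over an arbitrary R : realType; the complex
   numbers are R[i], and vectors are column matrices. *)
From HB Require Import structures.
From mathcomp Require Import all_boot all_order all_algebra.
From mathcomp Require Import spectral.
From mathcomp Require Export complex.
From mathcomp Require Import all_classical all_reals all_analysis.

Set Implicit Arguments.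
Unset Strict Implicit.
Unset Printing Implicit Defensive.
Import Order.TTheory GRing.Theory Num.Theory.
Import numFieldNormedType.Exports.
Local Open Scope ring_scope.
Local Open Scope sesquilinear_scope.
Local Open Scope complex_scope.

Section Vectors.
Variable R : realType.

Definition cplx m n (M : 'M[R]_(m, n)) : 'M[R[i]]_(m, n) :=
  map_mx (real_complex R) M.

Definition dotc d (u v : 'cV[R[i]]_d) : R[i] := (u ^t* *m v) 0 0.

Definition dotr d (u v : 'cV[R]_d) : R := (u^T *m v) 0 0.

Definition orthonormal_basis d (I : finType) (e : I -> 'cV[R[i]]_d) : Prop :=
  (forall i j, dotc (e i) (e j) = (i == j)%:R) /\
  (forall v, exists c : I -> R[i], v = \sum_i c i *: e i).

Definition unit_left_eigenvector d (A : 'M[R]_d) (nu : R[i])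
    (f : 'cV[R[i]]_d) : Prop :=
  dotc f f = 1 /\ f ^t* *m cplx A = nu *: f ^t*.

(* With algebraic multiplicity, A has p real eigenvalues and q conjugate pairs
   of non-real ones. *)
Definition eigenvalue_count d (A : 'M[R]_d) (p q : nat) : Prop :=
  exists (r : 'I_p -> R) (z : 'I_q -> R[i]),
    (forall k, complex.Im (z k) != 0) /\
    char_poly (cplx A) =
      \prod_k ('X - ((r k)%:C)%:P)
      * \prod_k (('X - (z k)%:P) * ('X - ((z k)^*)%:P)).

Definition eigenframe d p q (f : 'I_p -> 'cV[R]_d) (g : 'I_q -> 'cV[R[i]]_d)
    (s : 'I_p + ('I_q + 'I_q)) : 'cV[R[i]]_d :=
  match s with
  | inl k => cplx (f k)
  | inr (inl k) => g k
  | inr (inr k) => map_mx Num.conj (g k)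
  end.

End Vectors.

Section Polynomials.
Variable R : realType.

Fixpoint He (n : nat) : {poly R} :=
  match n with
  | 0 => 1
  | n1.+1 => match n1 with
             | 0 => 'X
             | n2.+1 => 'X * He n1 - n1%:R *: He n2
             end
  end.

(* Rodrigues' formula, for alpha in N. Because 0^-1 = 0, its value at x = 0 is
   0 when alpha > 0, instead of the value of the Laguerre polynomial. J below
   is not affected: there L_n^alpha (|z|^2) is multiplied by z^alpha or
   (z^* )^alpha. *)
Definition laguerre (n alpha : nat) (x rho : R) : R :=
  rho ^+ n / n`!%:R * x ^- alpha * expR (x / rho)
  * derive1n n (fun t => expR (- t / rho) * t ^+ (n + alpha)) x.

(* J_{m,n} (z, z^*; rho) *)
Definition J (m n : nat) (z : R[i]) (rho : R) : R[i] :=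
  let x := complex.Re (z * z^*) in
  if (n <= m)%N
  then (-1) ^+ n * n`!%:R * z ^+ (m - n) * (laguerre n (m - n) x rho)%:C
  else (-1) ^+ m * m`!%:R * z^* ^+ (n - m) * (laguerre m (n - m) x rho)%:C.

End Polynomials.

Section Operators.
Variables (R : realType) (d : nat).
Implicit Types (psi : 'cV[R]_d -> R[i]) (x : 'cV[R]_d).

Definition partial (i : 'I_d) psi x : R[i] :=
  'D_(delta_mx i 0) (fun y => complex.Re (psi y)) x
  +i* 'D_(delta_mx i 0) (fun y => complex.Im (psi y)) x.

Definition has_partial (i : 'I_d) psi x : Prop :=
  derivable (fun y => complex.Re (psi y)) x (delta_mx i 0) /\
  derivable (fun y => complex.Im (psi y)) x (delta_mx i 0).

Definition ornstein_uhlenbeck (A Q : 'M[R]_d) psi x : R[i] :=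
  \sum_i ((A *m x) i 0)%:C * partial i psi x
  + \sum_i \sum_j (Q i j)%:C * partial i (partial j psi) x.

(* 'D_v is a total function, so the existence of all the partial derivatives
   that enter the operator is required separately. *)
Definition ou_eigenfunction (A Q : 'M[R]_d) (mu : R[i]) psi : Prop :=
  [/\ forall i x, has_partial i psi x,
      forall i j x, has_partial i (partial j psi) x,
      exists x, psi x != 0
    & forall x, ornstein_uhlenbeck A Q psi x = mu * psi x].

End Operators.

Section Eigenfunctions.
Variables (R : realType) (d p q : nat).
Variables (f : 'I_p -> 'cV[R]_d) (lam s : 'I_p -> R).
Variables (g : 'I_q -> 'cV[R[i]]_d) (a b t : 'I_q -> R).
Variables (n : 'I_p -> nat) (n1 n2 : 'I_q -> nat).

(* The family f_1, ..., f_l is split into its real part f, with eigenvalue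
   parameters lam and B-eigenvalues s, and its non-real part g, with
   parameters a - i b and B-eigenvalues t. The family n1, n2 collects the
   pairs (n_k1, n_k2).
   The complex coordinate of x along g k is (g k)^* x = <g k, x>, for the inner
   product <u, v> = u^* v. It is the coordinate whose drift is - (a_k - i b_k),
   by (g k)^* A = - (a_k - i b_k) (g k)^*; with the conjugate coordinate
   <x, g k> = x^T g k the eigenvalue is the conjugate of mu below. *)
Definition phi (x : 'cV[R]_d) : R[i] :=
  (\prod_k (He R (n k)).[Num.sqrt (2 * lam k / s k ^+ 2) * dotr x (f k)])%:C
  * \prod_k J (n1 k) (n2 k) ((Num.sqrt 2)%:C * dotc (g k) (cplx x))
              (t k ^+ 2 / a k).

Definition mu : R[i] :=
  (\sum_k - (n k)%:R * lam k)%:C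
  - \sum_k (((n1 k + n2 k)%:R * a k)%:C
            - 'i * (((n1 k)%:R - (n2 k)%:R) * b k)%:C).

End Eigenfunctions.

(* Main.v *)
Require Import Defs.
From mathcomp Require Import all_boot all_order all_algebra.
From mathcomp Require Import complex.
From mathcomp Require Import all_classical all_reals all_analysis.
From mathcomp Require Import ring zify.
Import Order.TTheory GRing.Theory Num.Theory.
Import numFieldNormedType.Exports.
Local Open Scope ring_scope.
Local Open Scope complex_scope.
Set Implicit Arguments.
Unset Strict Implicit.
Unset Printing Implicit Defensive.

(** The operator L = ornstein_uhlenbeck A Q satisfies the product rule
      L (F G) = (L F) G + F (L G) + 2 Gamma (F, G),
    where Gamma (F, G) = \sum_ij Q_ij (d_i F) (d_j G) is the carre du champ
    ([ou_mul]).  Hence a product of eigenfunctions that are pairwise orthogonal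
    for Gamma is an eigenfunction, whose eigenvalue is the sum of the
    eigenvalues of the factors ([ou_prod]).

    The function [phi] is such a product, with one factor for each real
    eigenvector f_k and one for each pair (g_k, conj g_k).  Each factor depends
    on x only through the coordinates of x along its own eigenvectors.  Since
    B, hence Q, is diagonal in the orthonormal eigenframe, the factors are
    orthogonal for Gamma ([carre_du_champ_block]), and L acts on each factor by
    an operator in one real or one complex variable ([ou_grad_span]).  For a
    real eigenvector this is the Hermite equation ([ou_He]).  For a pair, with
    z = sqrt 2 <g_k, x>, it is
      - (a - i b) z d_z - (a + i b) z^* d_z^* + 2 a rho d_z d_z^*,
    and the factor J is the complex Hermite polynomial [chermite], determined by
      K_{m+1,n} = z K_{m,n} - n rho K_{m,n-1},    K_{0,n} = (z^* )^n.
    From d_z K_{m,n} = m K_{m-1,n}, from d_z^* K_{m,n} = n K_{m,n-1} and from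
    the mirror recurrence in n, the eigenvalue equation follows
    ([ou_chermite]).  The identification of J, which is given by Rodrigues'
    formula, with [chermite] ([J_chermite]) rests on the case z^* = 1, where
    the recurrence in n reads K_{m,n+1} = K_{m,n} - rho (d_z K_{m,n}).

    Finally [phi] is not the zero function ([phi_neq0]): the coordinates along
    f_k and g_k can be given any real values, and on such values each factor is
    a nonzero polynomial of its own coordinate. *)

(** * Complex Hermite polynomials *)

(** The polynomial \sum_k (-1)^k k! 'C(m, k) 'C(n, k) rho^k z^(m-k) w^(n-k),
    defined by its recurrence in m.  The variable w stands for the conjugate of
    z, but is independent of it.  At n = 0 the term with index n.-1 = 0 has the
    coefficient 0. *)
Fixpoint chermite (S : comNzRingType) (rho z w : S) (m n : nat) : S :=
  match m with
  | 0 => w ^+ n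
  | m1.+1 => z * chermite rho z w m1 n
             - n%:R * rho * chermite rho z w m1 n.-1
  end.
Arguments chermite : simpl never.

Section ComplexHermite.
Variable S : comNzRingType.
Implicit Types rho z w : S.

Lemma chermite0n rho z w n : chermite rho z w 0 n = w ^+ n.
Proof. by []. Qed.

Lemma chermiteS rho z w m n :
  chermite rho z w m.+1 n
  = z * chermite rho z w m n - n%:R * rho * chermite rho z w m n.-1.
Proof. by []. Qed.

Lemma chermiten0 rho z w m : chermite rho z w m 0 = z ^+ m.
Proof.
elim: m => [|m IH]; first by rewrite chermite0n !expr0.
by rewrite chermiteS IH exprS !mul0r subr0.
Qed.

Lemma chermiteSr rho z w m n :
  chermite rho z w m n.+1
  = w * chermite rho z w m n - m%:R * rho * chermite rho z w m.-1 n.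
Proof.
elim: m n => [|m IH] n; first by rewrite !chermite0n exprS !mul0r subr0.
rewrite chermiteS /= [chermite rho z w m.+1 n]chermiteS IH.
case: n => [|n] /=.
  rewrite !chermiten0; case: m {IH} => [|m] /=; rewrite ?exprS; ring.
case: m IH => [|m] IH /=.
  by rewrite !chermite0n !exprS; ring.
have E1 := chermiteS rho z w m n.+1; have E2 := IH n; rewrite /= in E1 E2.
apply/eqP; rewrite -subr_eq0; apply/eqP.
transitivity (m.+1%:R * rho * (chermite rho z w m.+1 n.+1
     - (z * chermite rho z w m n.+1 - n.+1%:R * rho * chermite rho z w m n))
   - n.+1%:R * rho * (chermite rho z w m.+1 n.+1
     - (w * chermite rho z w m.+1 n - m.+1%:R * rho * chermite rho z w m n))).
  ring.
by rewrite -E1 -E2 !subrr !mulr0 subr0.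
Qed.

Lemma chermiteC rho z w m n : chermite rho z w m n = chermite rho w z n m.
Proof.
elim: m n => [|m IH] n; first by rewrite chermiten0.
by rewrite chermiteS chermiteSr !IH.
Qed.

(** Homogeneity of weight m - n, where z has weight 1 and w has weight -1. *)
Lemma chermite_hom rho z w m n : (n <= m)%N ->
  chermite rho (z * w) 1 m n = w ^+ (m - n) * chermite rho z w m n.
Proof.
elim: n m => [|n IH] [|m] // le_nm.
- by rewrite !chermite0n !expr1n expr0 mulr1.
- by rewrite !chermiten0 exprMn subn0 mulrC.
rewrite !chermiteSr /= mul1r !IH //; last by rewrite ltnW.
by rewrite subSS subSn // exprS; ring.
Qed.

Lemma chermite00 rho m n : m != n -> chermite rho 0 0 m n = 0.
Proof.
elim: m n => [|m IH] [|n] // neq_mn.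
- by rewrite chermite0n expr0n.
- by rewrite chermiten0 expr0n.
by rewrite chermiteS /= mul0r (IH n) // mulr0 subr0.
Qed.

End ComplexHermite.

Lemma rmorph_chermite (S T : comNzRingType) (h : {rmorphism S -> T})
    (rho z w : S) m n :
  h (chermite rho z w m n) = chermite (h rho) (h z) (h w) m n.
Proof.
elim: m n => [|m IH] n; first by rewrite !chermite0n rmorphXn.
by rewrite !chermiteS rmorphB !rmorphM rmorph_nat !IH.
Qed.

Lemma coef_chermite (S : comNzRingType) (rho : S) m n k : (m + n <= k)%N ->
  (chermite rho%:P 'X 'X m n)`_k = (k == m + n)%:R.
Proof.
elim: m n k => [|m IH] n k le_k; first by rewrite chermite0n coefXn.
rewrite chermiteS coefB coefXM -mulrA -polyC_natr !coefCM.
case: k le_k => [|k] le_k; first by lia.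
rewrite /= IH; last by lia.
rewrite IH; last by lia.
rewrite (_ : (k.+1 == m + n.-1)%N = false); last by lia.
by rewrite !mulr0 subr0.
Qed.

(** * Rodrigues' formula *)

Section Rodrigues.
Variable R : realType.
Implicit Types (x rho : R) (z : R[i]).

Lemma is_derive_chermite rho x m n :
  is_derive x 1 (fun u : R => chermite rho u 1 m n)
    (m%:R * chermite rho x 1 m.-1 n).
Proof.
elim: m n => [|m IH] n.
  rewrite mul0r; under eq_fun do rewrite chermite0n expr1n.
  exact: is_derive_cst.
have D1 := is_deriveM (is_derive_id x 1) (IH n).
have D2 := is_deriveZ (n%:R * rho) (IH n.-1).
apply: (is_derive_eq (is_deriveB D1 D2)) => /=; rewrite /GRing.scale /=.
case: m IH {D1 D2} => [|m] IH /=; rewrite ?chermite0n ?expr1n; first by ring.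
by rewrite [chermite _ _ _ m.+1 n]chermiteS; ring.
Qed.

(** The derivative of e^(-t/rho) P is - rho^-1 e^(-t/rho) (P - rho P'), and at
    w = 1 the map P |-> P - rho P' raises the index n of [chermite]. *)
Lemma derive1n_expR_monomial rho N n x : rho != 0 ->
  derive1n n (fun t => expR (- t / rho) * t ^+ N) x
  = (- rho) ^- n * (expR (- x / rho) * chermite rho x 1 N n).
Proof.
move=> rho0; elim: n x => [|n IH] x.
  by rewrite expr0 invr1 mul1r chermiten0.
rewrite derive1nS (_ : derive1n n _ =
    fun t => (- rho) ^- n * (expR (- t / rho) * chermite rho t 1 N n));
  last by apply/funext.
rewrite derive1E.
have DE : is_derive x 1 (fun t : R => expR (- t / rho))
    (expR (- x / rho) * - rho^-1).
  apply: (is_derive1_comp (f := expR) (g := fun t : R => - t / rho)).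
  rewrite (_ : (fun t : R => - t / rho) = (- rho^-1) *: (id : R -> R)).
    apply: (is_derive_eq (is_deriveZ _ (is_derive_id x 1))).
    by rewrite /GRing.scale /= mulr1.
  apply/funext => t; rewrite [RHS](_ : _ = - rho^-1 * t) //.
  by rewrite !mulNr mulrC.
have D := is_deriveZ ((- rho) ^- n)
  (is_deriveM DE (is_derive_chermite rho x N n)).
rewrite [LHS](@derive_val _ _ _ _ _ _ _ D) chermiteSr /GRing.scale /=.
rewrite exprS invfM; field.
by rewrite expf_neq0 ?oppr_eq0 //= rho0.
Qed.

Lemma real_complex_chermite rho x y m n :
  (chermite rho x y m n)%:C = chermite rho%:C x%:C y%:C m n.
Proof. exact: (rmorph_chermite (real_complex R)). Qed.

Lemma mulJ_Re z : (complex.Re (z * Num.conj z))%:C = z * Num.conj z.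
Proof. by rewrite RRe_real // ger0_real // mul_conjC_ge0. Qed.

Lemma laguerre_chermite rho z m n : rho != 0 -> (n <= m)%N ->
  (-1) ^+ n * n`!%:R * z ^+ (m - n) *
    (laguerre n (m - n) (complex.Re (z * Num.conj z)) rho)%:C
  = chermite rho%:C z (Num.conj z) m n.
Proof.
move=> rho0 le_nm; rewrite /laguerre subnKC // derive1n_expR_monomial //.
set x := complex.Re _; set e1 := expR _; set e2 := expR _.
have e12 : e1 * e2 = 1 by rewrite -expRD -mulrDl subrr mul0r expR0.
have rhoC : rho%:C != 0 :> R[i] by rewrite fmorph_eq0.
have fact0 : n`!%:R != 0 :> R[i] by rewrite pnatr_eq0 -lt0n fact_gt0.
rewrite (_ : _ * (_ * (e2 * _)) = n`!%:R^-1 * (-1) ^- n *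
   (x ^- (m - n) * chermite rho x 1 m n)); last first.
  rewrite (_ : - rho = -1 * rho); last by rewrite mulN1r.
  rewrite exprMn.
  have fact1 : n`!%:R != 0 :> R by rewrite pnatr_eq0 -lt0n fact_gt0.
  transitivity (n`!%:R^-1 * (-1) ^- n *
   (x ^- (m - n) * chermite rho x 1 m n) * (e1 * e2)).
    2: by rewrite e12 mulr1.
  rewrite invfM.
  have {2}-> : chermite rho x 1 m n =
    rho ^+ n * rho ^- n * chermite rho x 1 m n.
    by rewrite mulfV ?mul1r // expf_neq0.
  ring.
have xE : x%:C = z * Num.conj z by exact: mulJ_Re.
transitivity (z ^+ (m - n) * (x ^- (m - n) * chermite rho x 1 m n)%:C).
  set P := x ^- _ * _.
  rewrite rmorphM rmorphM !fmorphV rmorph_nat rmorphXn rmorphN1; field.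
  by rewrite signr_eq0 fact0.
rewrite rmorphM fmorphV rmorphXn /= real_complex_chermite xE rmorph1.
rewrite chermite_hom // exprMn invfM.
(* At z = 0 both sides vanish unless m = n; in that case x ^- 0 = 1. *)
have [z0|z0] := eqVneq z 0; last first.
  have zb0 : Num.conj z != 0 by rewrite conjC_eq0.
  by field; rewrite !expf_neq0.
rewrite z0 conjC0; have [->|neq_mn] := eqVneq m n.
  by rewrite subnn !expr0 invr1 !mul1r.
by rewrite chermite00 // !mulr0.
Qed.

Lemma J_chermite rho m n z : rho != 0 ->
  J m n z rho = chermite rho%:C z (Num.conj z) m n.
Proof.
move=> rho0; rewrite /J; case: ifPn => [|]; first exact: laguerre_chermite.
rewrite -ltnNge => /ltnW lt_mn.
rewrite chermiteC; have := laguerre_chermite (Num.conj z) rho0 lt_mn.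
by rewrite conjCK [X in complex.Re X]mulrC.
Qed.

End Rodrigues.

(** * Polynomial functions and their partial derivatives *)

Section PolynomialFunctions.
Variables (R : realType) (d : nat).
Implicit Types (F G : 'cV[R]_d -> R[i]) (x : 'cV[R]_d).

(** Complex-valued polynomial functions of a real vector.  They have all partial
    derivatives, which are again polynomial functions. *)
Inductive polyfun : ('cV[R]_d -> R[i]) -> Prop :=
  | PolyConst c : polyfun (fun=> c)
  | PolyCoord k : polyfun (fun x => (x k 0)%:C)
  | PolyAdd F G : polyfun F -> polyfun G -> polyfun (fun x => F x + G x)
  | PolyMul F G : polyfun F -> polyfun G -> polyfun (fun x => F x * G x).

(** F has the i-th partial derivative D at x. *)
Definition cpartial (i : 'I_d) F x (D : R[i]) :=
  is_derive x (delta_mx i 0) (fun y => complex.Re (F y)) (complex.Re D) /\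
  is_derive x (delta_mx i 0) (fun y => complex.Im (F y)) (complex.Im D).

Lemma cpartialP i F x D : cpartial i F x D ->
  has_partial i F x /\ partial i F x = D.
Proof.
case=> D1 D2; split; first by split; exact: ex_derive.
by rewrite /partial !derive_val; case: D {D1 D2}.
Qed.

Lemma has_partialP i F x : has_partial i F x -> cpartial i F x (partial i F x).
Proof. by case=> D1 D2; split; apply: derivableP. Qed.

Lemma cpartial_cst i c x : cpartial i (fun=> c) x 0.
Proof. by split; apply: is_derive_cst. Qed.

Lemma is_derive_coord (k i : 'I_d) x :
  is_derive x (delta_mx i 0) (fun y : 'cV[R]_d => y k 0) (k == i)%:R.
Proof.
have cvq : ((fun h : R => h^-1 *: (((fun y : 'cV[R]_d => y k 0) \o shift x)
    (h *: delta_mx i 0) - x k 0)) @ 0^' --> ((k == i)%:R : R))%classic.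
  apply: cvg_near_cst; near=> h.
  rewrite /= !mxE eqxx andbT addrK /GRing.scale /= mulrA mulVf ?mul1r //.
  by near: h; exact: nbhs_dnbhs_neq.
by split; [apply/cvg_ex; exists (k == i)%:R | apply/cvg_lim].
Unshelve. all: by end_near. Qed.

Lemma cpartial_coord i k x : cpartial i (fun y => (y k 0)%:C) x (k == i)%:R.
Proof.
split; first by case: eqP (is_derive_coord k i x) => _.
by case: eqP => _ /=; exact: is_derive_cst.
Qed.

Lemma ReD (u v : R[i]) : complex.Re (u + v) = complex.Re u + complex.Re v.
Proof. by case: u v => [? ?] [? ?]. Qed.

Lemma ImD (u v : R[i]) : complex.Im (u + v) = complex.Im u + complex.Im v.
Proof. by case: u v => [? ?] [? ?]. Qed.

Lemma ReM (u v : R[i]) : complex.Re (u * v)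
  = complex.Re u * complex.Re v - complex.Im u * complex.Im v.
Proof. by case: u v => [? ?] [? ?]. Qed.

Lemma ImM (u v : R[i]) : complex.Im (u * v)
  = complex.Re u * complex.Im v + complex.Im u * complex.Re v.
Proof. by case: u v => [? ?] [? ?]. Qed.

Lemma cpartialD i F G x DF DG : cpartial i F x DF -> cpartial i G x DG ->
  cpartial i (fun y => F y + G y) x (DF + DG).
Proof.
move=> [F1 F2] [G1 G2]; rewrite /cpartial ReD ImD; split.
  by under eq_fun do rewrite ReD; exact: is_deriveD.
by under eq_fun do rewrite ImD; exact: is_deriveD.
Qed.

Lemma cpartialM i F G x DF DG : cpartial i F x DF -> cpartial i G x DG ->
  cpartial i (fun y => F y * G y) x (DF * G x + F x * DG).
Proof.
move=> [F1 F2] [G1 G2]; split.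
  under eq_fun do rewrite ReM.
  apply: (is_derive_eq (is_deriveB (is_deriveM F1 G1) (is_deriveM F2 G2))).
  by rewrite ReD !ReM /GRing.scale /=; ring.
under eq_fun do rewrite ImM.
apply: (is_derive_eq (is_deriveD (is_deriveM F1 G2) (is_deriveM F2 G1))).
by rewrite ImD !ImM /GRing.scale /=; ring.
Qed.

Lemma polyfun_has_partial i F x : polyfun F -> has_partial i F x.
Proof.
elim=> [c|k|F1 F2 _ H1 _ H2|F1 F2 _ H1 _ H2].
- exact: (cpartialP (cpartial_cst i c x)).1.
- exact: (cpartialP (cpartial_coord i k x)).1.
- exact: (cpartialP (cpartialD (has_partialP H1) (has_partialP H2))).1.
- exact: (cpartialP (cpartialM (has_partialP H1) (has_partialP H2))).1.
Qed.

Lemma partial_cst i c :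
  partial i (fun=> c) = (fun=> 0 : R[i]) :> ('cV[R]_d -> _).
Proof. by apply/funext => x; rewrite (cpartialP (cpartial_cst i c x)).2. Qed.

Lemma partial_coord i k :
  partial i (fun y => (y k 0)%:C)
  = (fun=> (k == i)%:R : R[i]) :> ('cV[R]_d -> _).
Proof. by apply/funext => x; rewrite (cpartialP (cpartial_coord i k x)).2. Qed.

Lemma partialD i F G : polyfun F -> polyfun G ->
  partial i (fun y => F y + G y) = (fun x => partial i F x + partial i G x).
Proof.
move=> PF PG; apply/funext => x.
have DF := has_partialP (polyfun_has_partial i x PF).
have DG := has_partialP (polyfun_has_partial i x PG).
by rewrite (cpartialP (cpartialD DF DG)).2.
Qed.

Lemma partialM i F G : polyfun F -> polyfun G ->
  partial i (fun y => F y * G y)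
  = (fun x => partial i F x * G x + F x * partial i G x).
Proof.
move=> PF PG; apply/funext => x.
have DF := has_partialP (polyfun_has_partial i x PF).
have DG := has_partialP (polyfun_has_partial i x PG).
by rewrite (cpartialP (cpartialM DF DG)).2.
Qed.

Lemma polyfun_partial i F : polyfun F -> polyfun (partial i F).
Proof.
elim=> [c|k|F1 F2 P1 H1 P2 H2|F1 F2 P1 H1 P2 H2].
- by rewrite partial_cst; exact: PolyConst.
- by rewrite partial_coord; exact: PolyConst.
- by rewrite partialD //; exact: PolyAdd.
- by rewrite partialM //; apply: PolyAdd; apply: PolyMul.
Qed.

Lemma polyfunZ c F : polyfun F -> polyfun (fun x => c * F x).
Proof. by move=> PF; apply: PolyMul => //; exact: PolyConst. Qed.

Lemma partialZ i c F : polyfun F ->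
  partial i (fun x => c * F x) = (fun x => c * partial i F x).
Proof.
move=> PF; rewrite partialM //; last exact: PolyConst.
by rewrite partial_cst; apply/funext => x; rewrite mul0r add0r.
Qed.

Lemma polyfunB F G : polyfun F -> polyfun G -> polyfun (fun x => F x - G x).
Proof.
move=> PF PG; have := PolyAdd PF (polyfunZ (-1) PG).
by under eq_fun do rewrite mulN1r.
Qed.

Lemma partialB i F G : polyfun F -> polyfun G ->
  partial i (fun y => F y - G y) = (fun x => partial i F x - partial i G x).
Proof.
move=> PF PG; transitivity (partial i (fun y => F y + (-1) * G y)).
  by congr partial; apply/funext => x; rewrite mulN1r.
rewrite partialD // ?partialZ //; last exact: polyfunZ.
by apply/funext => x; rewrite mulN1r.
Qed.

(** The complex linear form with coefficients u, without conjugation. *)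
Definition linform (u : 'cV[R[i]]_d) x : R[i] := \sum_k u k 0 * (x k 0)%:C.

Lemma polyfun_sum (I : Type) (r : seq I) (F : I -> 'cV[R]_d -> R[i]) :
  (forall j, polyfun (F j)) -> polyfun (fun x => \sum_(j <- r) F j x).
Proof.
move=> PF; elim: r => [|j r IH].
  by under eq_fun do rewrite big_nil; exact: PolyConst.
by under eq_fun do rewrite big_cons; exact: PolyAdd.
Qed.

Lemma partial_sum i (I : Type) (r : seq I) (F : I -> 'cV[R]_d -> R[i]) :
  (forall j, polyfun (F j)) -> partial i (fun x => \sum_(j <- r) F j x)
  = (fun x => \sum_(j <- r) partial i (F j) x).
Proof.
move=> PF; elim: r => [|j r IH].
  under eq_fun do rewrite big_nil.
  by rewrite partial_cst; apply/funext => x; rewrite big_nil.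
under eq_fun do rewrite big_cons.
rewrite partialD ?IH //; last exact: polyfun_sum.
by apply/funext => x; rewrite big_cons.
Qed.

Lemma polyfun_prod (I : Type) (r : seq I) (F : I -> 'cV[R]_d -> R[i]) :
  (forall j, polyfun (F j)) -> polyfun (fun x => \prod_(j <- r) F j x).
Proof.
move=> PF; elim: r => [|j r IH].
  by under eq_fun do rewrite big_nil; exact: PolyConst.
by under eq_fun do rewrite big_cons; exact: PolyMul.
Qed.

Lemma polyfun_linform u : polyfun (linform u).
Proof. by apply: polyfun_sum => k; apply: polyfunZ; exact: PolyCoord. Qed.

Lemma partial_linform i u : partial i (linform u) = (fun=> u i 0).
Proof.
rewrite /linform partial_sum; last first.
  by move=> k; apply: polyfunZ; exact: PolyCoord.
apply/funext => x; rewrite (bigD1 i) //= big1 => [|k /negPf ki].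
  by rewrite partialZ ?partial_coord ?eqxx ?mulr1 ?addr0 //; exact: PolyCoord.
by rewrite partialZ ?partial_coord ?ki ?mulr0 //; exact: PolyCoord.
Qed.

End PolynomialFunctions.

(** * The Ornstein-Uhlenbeck operator on products *)

(* Comparing two instances of partial by unfolding them down to limits is very
   slow. *)
Local Opaque partial.

Section Operator.
Variables (R : realType) (d : nat) (A Q : 'M[R]_d).
Hypothesis Q_sym : Q^T = Q.
Implicit Types (F G : 'cV[R]_d -> R[i]) (u v : 'cV[R[i]]_d) (x : 'cV[R]_d).

Local Notation L := (ornstein_uhlenbeck A Q).

(** The complex bilinear form of Q. *)
Definition qform u v : R[i] := \sum_i \sum_j (Q i j)%:C * (u i 0 * v j 0).

(** The carre du champ of F and G, bilinear rather than sesquilinear. *)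
Definition carre_du_champ F G x : R[i] :=
  \sum_i \sum_j (Q i j)%:C * (partial i F x * partial j G x).
Local Notation Gam := carre_du_champ.


Lemma sum_sym_swap (a b : 'I_d -> R[i]) :
  \sum_i \sum_j (Q i j)%:C * (a i * b j)
  = \sum_i \sum_j (Q i j)%:C * (b i * a j).
Proof.
rewrite exchange_big; apply: eq_bigr => i _; apply: eq_bigr => j _.
by rewrite -[Q in LHS]Q_sym mxE [b i * _]mulrC.
Qed.

Lemma carre_du_champC F G x : Gam F G x = Gam G F x.
Proof. exact: sum_sym_swap. Qed.

Lemma qformC u v : qform u v = qform v u.
Proof. exact: sum_sym_swap. Qed.

(** The first-order part of the operator. *)
Definition drift F x : R[i] := \sum_i ((A *m x) i 0)%:C * partial i F x.

(** The second-order part of the operator. *)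
Definition diffusion F x : R[i] :=
  \sum_i \sum_j (Q i j)%:C * partial i (partial j F) x.

Lemma ouE F x : L F x = drift F x + diffusion F x.
Proof. by []. Qed.

Lemma driftM F G x : polyfun F -> polyfun G ->
  drift (fun y => F y * G y) x = drift F x * G x + F x * drift G x.
Proof.
move=> PF PG; rewrite /drift mulr_suml mulr_sumr -big_split.
by apply: eq_bigr => i _ /=; rewrite partialM //; ring.
Qed.

Lemma diffusionM F G x : polyfun F -> polyfun G ->
  diffusion (fun y => F y * G y) x
  = diffusion F x * G x + F x * diffusion G x + (Gam F G x + Gam G F x).
Proof.
move=> PF PG; rewrite /diffusion /carre_du_champ.
rewrite mulr_suml mulr_sumr -!big_split.
apply: eq_bigr => i _ /=; rewrite mulr_suml mulr_sumr -!big_split.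
apply: eq_bigr => j _ /=; rewrite partialM //.
rewrite partialD; try by apply: PolyMul => //; exact: polyfun_partial.
rewrite !partialM //; try exact: polyfun_partial.
(* Variables in place of the derivatives keep ring from comparing them up to
   conversion. *)
move: (partial i (partial j F) x) (partial i (partial j G) x) (F x) (G x).
move: (partial i F x) (partial i G x) (partial j F x) (partial j G x).
move: (Q i j)%:C => *.
by ring.
Qed.

Lemma ou_mul F G x : polyfun F -> polyfun G ->
  L (fun y => F y * G y) x = L F x * G x + F x * L G x + 2 * Gam F G x.
Proof.
move=> PF PG; rewrite !ouE driftM // diffusionM // [Gam G F x]carre_du_champC.
move: (drift F x) (drift G x) (diffusion F x) (diffusion G x) (Gam F G x) => *.
move: (F x) (G x) => *; ring.
Qed.

Lemma carre_du_champ_mulr F G1 G2 x : polyfun G1 -> polyfun G2 ->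
  Gam F (fun y => G1 y * G2 y) x = Gam F G1 x * G2 x + G1 x * Gam F G2 x.
Proof.
move=> P1 P2; rewrite /carre_du_champ mulr_suml mulr_sumr -big_split.
apply: eq_bigr => i _; rewrite mulr_suml mulr_sumr -big_split.
by apply: eq_bigr => j _; rewrite partialM //=; ring.
Qed.

Lemma ou_prod (I : eqType) (r : seq I) (F : I -> 'cV[R]_d -> R[i])
    (m : I -> R[i]) x : uniq r ->
  (forall k, polyfun (F k)) -> (forall k, L (F k) x = m k * F k x) ->
  (forall k l, k != l -> Gam (F k) (F l) x = 0) ->
  L (fun y => \prod_(k <- r) F k y) x
  = (\sum_(k <- r) m k) * \prod_(k <- r) F k x.
Proof.
move=> r_uniq PF LF G0.
have L0 c : L (fun=> c) x = 0.
  rewrite /ornstein_uhlenbeck !big1 ?addr0 // => i _; last first.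
    by rewrite partial_cst mulr0.
  by rewrite big1 // => j _; rewrite !partial_cst mulr0.
have Gp k s : k \notin s -> Gam (F k) (fun y => \prod_(l <- s) F l y) x = 0.
  elim: s => [|l s IH].
    under [X in Gam _ X]eq_fun do rewrite big_nil.
    move=> _; rewrite /carre_du_champ big1 // => i _.
    by rewrite big1 // => j _; rewrite partial_cst !mulr0.
  rewrite inE negb_or => /andP[kl ks].
  under [X in Gam _ X]eq_fun do rewrite big_cons.
  rewrite carre_du_champ_mulr //; last exact: polyfun_prod.
  by rewrite G0 // IH // mul0r mulr0 addr0.
elim: r r_uniq => [_|k r IH /= /andP[kr r_uniq]].
  by under eq_fun do rewrite big_nil; rewrite L0 !big_nil mul0r.
under eq_fun do rewrite big_cons.
rewrite ou_mul //; last exact: polyfun_prod.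
by rewrite Gp // IH // LF !big_cons; ring.
Qed.

(** The gradient of F is u G1 + v G2, as when F is a function of the two
    coordinates [linform u] and [linform v], with partial derivatives G1 and G2
    in these coordinates. *)
Definition grad_span u v F G1 G2 :=
  forall i, partial i F = (fun x => u i 0 * G1 x + v i 0 * G2 x).

Lemma carre_du_champ0 u v u' v' F G1 G2 F' G1' G2' x :
  grad_span u v F G1 G2 -> grad_span u' v' F' G1' G2' ->
  qform u u' = 0 -> qform u v' = 0 -> qform v u' = 0 -> qform v v' = 0 ->
  Gam F F' x = 0.
Proof.
move=> DF DF' q1 q2 q3 q4.
transitivity (G1 x * G1' x * qform u u' + G1 x * G2' x * qform u v'
  + G2 x * G1' x * qform v u' + G2 x * G2' x * qform v v'); last first.
  by rewrite q1 q2 q3 q4; ring.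
rewrite /carre_du_champ /qform !mulr_sumr -!big_split; apply: eq_bigr => i _ /=.
rewrite !mulr_sumr -!big_split; apply: eq_bigr => j _ /=.
by rewrite DF DF'; ring.
Qed.

(** The chain rule for a function of two linear coordinates: the operator
    depends only on the values of the coordinates at A x and on the values of
    [qform] on their coefficients. *)
Lemma ou_grad_span u v F G1 G2 G11 G12 G21 G22 x :
  polyfun G1 -> polyfun G2 ->
  grad_span u v F G1 G2 ->
  grad_span u v G1 G11 G12 -> grad_span u v G2 G21 G22 ->
  L F x = linform u (A *m x) * G1 x + linform v (A *m x) * G2 x
    + qform u u * G11 x + qform u v * (G12 x + G21 x) + qform v v * G22 x.
Proof.
move=> P1 P2 DF D1 D2; rewrite /ornstein_uhlenbeck -!addrA addrA.
congr (_ + _).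
  rewrite /linform !mulr_suml -big_split; apply: eq_bigr => i _ /=.
  by rewrite DF; ring.
transitivity (qform u u * G11 x + qform v u * G12 x + qform u v * G21 x
  + qform v v * G22 x); last by rewrite [qform v u]qformC; ring.
rewrite /qform !mulr_suml -!big_split; apply: eq_bigr => i _ /=.
rewrite !mulr_suml -!big_split; apply: eq_bigr => j _ /=.
rewrite DF partialD ?partialZ //; try exact: polyfunZ.
by rewrite D1 D2; ring.
Qed.

(** * The two kinds of eigenfunctions *)

Section Blocks.
Variables (u v : 'cV[R[i]]_d).

Lemma polyfun_chermite (r rho : R[i]) m n :
  polyfun (fun x => chermite rho (r * linform u x) (r * linform v x) m n).
Proof.
elim: m n => [|m IH] n.
  elim: n => [|n IH].
    by under eq_fun do rewrite chermite0n expr0; exact: PolyConst.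
  under eq_fun do rewrite chermite0n exprS.
  apply: PolyMul; last exact: IH.
  by apply: polyfunZ; exact: polyfun_linform.
under eq_fun do rewrite chermiteS; apply: polyfunB; last exact: polyfunZ.
by apply: PolyMul => //; apply: polyfunZ; exact: polyfun_linform.
Qed.

Lemma grad_chermite (r rho : R[i]) m n :
  let K m n := fun x => chermite rho (r * linform u x) (r * linform v x) m n in
  grad_span u v (K m n) (fun x => r * m%:R * K m.-1 n x)
    (fun x => r * n%:R * K m n.-1 x).
Proof.
move=> K i.
have Plin (w : 'cV[R[i]]_d) : polyfun (fun x => r * linform w x).
  by apply: polyfunZ; exact: polyfun_linform.
have Dlin (w : 'cV[R[i]]_d) :
    partial i (fun x => r * linform w x) = (fun=> r * w i 0).
  by rewrite partialZ ?partial_linform //; exact: polyfun_linform.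
have PK k l : polyfun (K k l) by exact: polyfun_chermite.
have KS k l x : K k.+1 l x
  = r * linform u x * K k l x - l%:R * rho * K k l.-1 x by [].
elim: m n => [|m IH] n.
  elim: n => [|n IH].
    rewrite [K _ _](_ : _ = fun=> 1) ?partial_cst; last by apply/funext.
    by apply/funext => x; ring.
  rewrite [K _ _](_ : _ = fun x => (r * linform v x) * K 0 n x); last first.
    by apply/funext => x; rewrite /K !chermite0n exprS.
  rewrite partialM // IH Dlin; apply/funext => x /=.
  case: n {IH} => [|n] /=; first by ring.
  by rewrite /K !chermite0n exprS; ring.
rewrite [K _ _](_ : _ = fun x => (r * linform u x) * K m n x
   - (n%:R * rho) * K m n.-1 x); last by apply/funext => x; rewrite KS.
rewrite partialB; [|exact: PolyMul|exact: polyfunZ].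
rewrite (partialM i (Plin u) (PK m n)) (partialZ i _ (PK m n.-1)) !IH Dlin.
apply/funext => x /=.
rewrite [K m.+1 n.-1 x]KS.
case: m {IH} => [|m] /=; first by ring.
by rewrite KS; ring.
Qed.

End Blocks.

Lemma grad_spanZ u v c F G1 G2 : polyfun F -> grad_span u v F G1 G2 ->
  grad_span u v (fun x => c * F x) (fun x => c * G1 x) (fun x => c * G2 x).
Proof. by move=> PF DF i; rewrite partialZ // DF; apply/funext => x; ring. Qed.

(** The complex Hermite polynomial in the coordinates z = r u^T x and
    w = r v^T x, with drifts - nu z and - nu' w, is an eigenfunction when rho
    matches the mixed diffusion coefficient.  The recurrences in m and in n
    give z K_{m-1,n} = K_{m,n} + n rho K_{m-1,n-1} and its mirror image, and the
    terms in K_{m-1,n-1} cancel. *)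
Lemma ou_chermite u v (r rho nu nu' : R[i]) m n x :
  linform u (A *m x) = - nu * linform u x ->
  linform v (A *m x) = - nu' * linform v x ->
  qform u u = 0 -> qform v v = 0 -> 2 * r ^+ 2 * qform u v = rho * (nu + nu') ->
  let K x := chermite rho (r * linform u x) (r * linform v x) m n in
  L K x = - (m%:R * nu + n%:R * nu') * K x.
Proof.
move=> Au Av quu qvv quv /=.
have PK k l := polyfun_chermite u v r rho k l.
have DK k l := grad_chermite u v r rho k l.
have D1 := grad_spanZ (r * m%:R) (PK m.-1 n) (DK m.-1 n).
have D2 := grad_spanZ (r * n%:R) (PK m n.-1) (DK m n.-1).
rewrite (ou_grad_span _ (polyfunZ _ (PK _ _)) (polyfunZ _ (PK _ _))
  (DK m n) D1 D2).
rewrite quu qvv Au Av {PK DK D1 D2 Au Av quu qvv}.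
move: (linform u x) (linform v x) (qform u v) quv => z w q quv.
have Km : m%:R * (r * z * chermite rho (r * z) (r * w) m.-1 n) =
    m%:R * (chermite rho (r * z) (r * w) m n
            + n%:R * rho * chermite rho (r * z) (r * w) m.-1 n.-1).
  by case: m => [|m] /=; rewrite ?mul0r // chermiteS subrK.
have Kn : n%:R * (r * w * chermite rho (r * z) (r * w) m n.-1) =
    n%:R * (chermite rho (r * z) (r * w) m n
            + m%:R * rho * chermite rho (r * z) (r * w) m.-1 n.-1).
  by case: n {Km} => [|n] /=; rewrite ?mul0r // chermiteSr subrK.
move: (chermite _ _ _ m.-1 n) (chermite _ _ _ m n.-1) (chermite _ _ _ m n)
  (chermite _ _ _ m.-1 n.-1) Km Kn => K1 K2 K0 K3 Km Kn.
transitivity (- nu * (m%:R * (r * z * K1)) - nu' * (n%:R * (r * w * K2))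
   + 2 * r ^+ 2 * q * (m%:R * n%:R * K3)); last by rewrite Km Kn quv; ring.
rewrite !mul0r; ring.
Qed.

Section Hermite.
Variables (c : R) (f : 'cV[R]_d).
Let u := cplx f.
Let h n x : R[i] := ((He R n).[c * dotr x f])%:C.

Lemma dotr_linform x : (dotr x f)%:C = linform u x.
Proof.
rewrite /dotr mxE rmorph_sum; apply: eq_bigr => k _.
by rewrite !mxE rmorphM mulrC.
Qed.

Lemma He_evalSS n x :
  h n.+2 x = c%:C * linform u x * h n.+1 x - n.+1%:R * h n x.
Proof.
rewrite -dotr_linform -[n.+1%:R in RHS](rmorph_nat (real_complex R)) /h.
rewrite (_ : He R n.+2 = 'X * He R n.+1 - n.+1%:R *: He R n) //.
by rewrite hornerD hornerN hornerM hornerX hornerZ rmorphB !rmorphM.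
Qed.

Lemma He_evalSS_fun n :
  h n.+2 = (fun x => c%:C * linform u x * h n.+1 x - n.+1%:R * h n x).
Proof. by apply/funext => x; exact: He_evalSS. Qed.

Lemma He_eval0 : h 0 = (fun=> 1).
Proof. by apply/funext => x; rewrite /h hornerC. Qed.

Lemma He_eval1 : h 1 = (fun x => c%:C * linform u x).
Proof. by apply/funext => x; rewrite /h hornerX rmorphM -dotr_linform. Qed.

Let Plin : polyfun (fun x => c%:C * linform u x).
Proof. by apply: polyfunZ; exact: polyfun_linform. Qed.

Lemma polyfun_He n : polyfun (h n).
Proof.
suff [] : polyfun (h n) /\ polyfun (h n.+1) by [].
elim: n => [|n [P0 P1]].
  by rewrite He_eval0 He_eval1; split=> //; exact: PolyConst.
split=> //; rewrite He_evalSS_fun.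
by apply: polyfunB; [exact: PolyMul|exact: polyfunZ].
Qed.

Lemma grad_He v n :
  grad_span u v (h n) (fun x => c%:C * n%:R * h n.-1 x) (fun=> 0).
Proof.
move=> i.
have Dlin : partial i (fun x => c%:C * linform u x) = (fun=> c%:C * u i 0).
  by rewrite partialZ ?partial_linform //; exact: polyfun_linform.
pose D k : 'cV[R]_d -> R[i] :=
  fun x => u i 0 * (c%:C * k%:R * h k.-1 x) + v i 0 * 0.
suff [] : (partial i (h n) = D n) /\ (partial i (h n.+1) = D n.+1) by [].
rewrite {}/D /=.
elim: n => [|n [IH0 IH1]].
  rewrite He_eval0 He_eval1 Dlin partial_cst.
  by split; apply/funext => x; ring.
split=> //; rewrite He_evalSS_fun.
have P0 := polyfun_He n; have P1 := polyfun_He n.+1.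
rewrite partialB; [|exact: PolyMul|exact: polyfunZ].
rewrite (partialM i Plin P1) (partialZ i _ P0) Dlin IH0 IH1.
apply/funext => x /=; case: n {IH0 IH1 P0 P1} => [|n] /=.
  by rewrite He_eval0 He_eval1; ring.
rewrite He_evalSS; ring.
Qed.

Lemma ou_He (lam : R[i]) n x :
  linform u (A *m x) = - lam * linform u x -> c%:C ^+ 2 * qform u u = lam ->
  L (h n) x = - (n%:R * lam) * h n x.
Proof.
move=> Au quu.
have D1 := grad_spanZ (c%:C * n%:R) (polyfun_He n.-1) (grad_He 0 n.-1).
have D2 : grad_span u 0 (fun=> 0) (fun=> 0) (fun=> 0).
  by move=> i; rewrite partial_cst; apply/funext => y; rewrite !mulr0 addr0.
have P1 := polyfunZ (c%:C * n%:R) (polyfun_He n.-1).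
have P2 : polyfun (fun _ : 'cV[R]_d => 0 : R[i]) by exact: PolyConst.
rewrite (ou_grad_span _ P1 P2 (grad_He 0 n) D1 D2) Au.
rewrite !mulr0 !addr0.
transitivity (- (lam * (n%:R * (c%:C * linform u x * h n.-1 x)))
   + (c%:C ^+ 2 * qform u u) * (n%:R * (n.-1%:R * h n.-2 x))); first by ring.
rewrite quu; case: n {D1 P1} => [|[|n]] /=; first by ring.
  by rewrite He_eval0 He_eval1; ring.
by rewrite He_evalSS; ring.
Qed.

End Hermite.
End Operator.

(** * Linear forms given by eigenvectors *)

Section Vectors.
Variables (R : realType) (d : nat).
Implicit Types (u v : 'cV[R[i]]_d) (x : 'cV[R]_d).

Local Notation "u ^J" := (map_mx Num.conj u) (at level 2, format "u ^J").

Lemma conj_real (c : R) : Num.conj c%:C = c%:C.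
Proof. exact: conjc_real. Qed.

Lemma conj_cplx m n (M : 'M[R]_(m, n)) : (cplx M)^J = cplx M.
Proof. by apply/matrixP => i j; rewrite !mxE conj_real. Qed.

Lemma conj_mxK m n (M : 'M[R[i]]_(m, n)) : M^J^J = M.
Proof. by apply/matrixP => i j; rewrite !mxE conjCK. Qed.

Lemma dotcE u v : dotc u v = \sum_k Num.conj (u k 0) * v k 0.
Proof. by rewrite /dotc mxE; apply: eq_bigr => k _; rewrite !mxE. Qed.

Lemma linform_conj u x : linform u^J x = dotc u (cplx x).
Proof. by rewrite dotcE; apply: eq_bigr => k _; rewrite !mxE. Qed.

Lemma conj_linform u x : Num.conj (linform u x) = linform u^J x.
Proof.
by rewrite rmorph_sum; apply: eq_bigr => k _; rewrite rmorphM /= conj_real mxE.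
Qed.

Lemma linform_left_eigenvector (A : 'M[R]_d) (nu : R[i]) u x :
  unit_left_eigenvector A nu u ->
  linform u^J (A *m x) = nu * linform u^J x.
Proof.
case=> _ uA; rewrite !linform_conj /dotc /cplx map_mxM mulmxA uA.
by rewrite -scalemxAl mxE.
Qed.

Lemma qform_eigenvector (Q : 'M[R]_d) (tau : R[i]) u v :
  cplx Q *m v = tau *: v -> qform Q u^J v = tau * dotc u v.
Proof.
move=> Qv; rewrite dotcE mulr_sumr; apply: eq_bigr => i _.
have := congr1 (fun M : 'cV_d => M i 0) Qv; rewrite !mxE => Qvi.
rewrite mulrCA -Qvi mulr_sumr; apply: eq_bigr => j _.
by rewrite !mxE; ring.
Qed.

End Vectors.

(** * Nonvanishing *)

Lemma poly_non_root (R : realType) (p : {poly R}) :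
  p != 0 -> exists r, p.[r] != 0.
Proof.
move=> p0; apply/not_existsP => H.
pose s := [seq i%:R : R | i <- iota 0 (size p)].
have s_uniq : uniq s.
  rewrite map_inj_uniq ?iota_uniq // => i j /eqP.
  by rewrite eqr_nat => /eqP.
have s_root : all (root p) s.
  by apply/allP => r _; rewrite rootE; apply/negPn/negP/(H r).
have := max_poly_roots p0 s_root s_uniq.
by rewrite size_map size_iota ltnn.
Qed.

Lemma coef_He (R : realType) n k : (n <= k)%N -> (He R n)`_k = (k == n)%:R.
Proof.
suff [] : (forall k, (n <= k)%N -> (He R n)`_k = (k == n)%:R)
  /\ (forall k, (n < k.+1)%N -> (He R n.+1)`_k.+1 = (k == n)%:R).
  by move=> + _; apply.
elim: n {k} => [|n [IH0 IH1]].
  by split=> k _; rewrite ?coefX ?coefC; case: k.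
split=> [[|k] // /IH1 //|k lt_k].
rewrite (_ : He R n.+2 = 'X * He R n.+1 - n.+1%:R *: He R n) //.
rewrite coefB coefXM coefZ /= IH0; last by lia.
case: k lt_k => [|k] lt_k; first by lia.
rewrite IH1; last by lia.
rewrite (_ : (k.+2 == n) = false) ?mulr0 ?subr0; last by lia.
by [].
Qed.

Lemma He_neq0 (R : realType) n : He R n != 0.
Proof.
apply/eqP => /(congr1 (fun p : {poly R} => p`_n)); apply/eqP.
by rewrite coef_He // eqxx coef0 oner_eq0.
Qed.

(** On the diagonal w = z = r the polynomial is monic of degree m + n in r. *)
Lemma chermite_neq0 (R : realType) (rho : R) m n :
  exists r, chermite rho r r m n != 0.
Proof.
have : chermite rho%:P 'X 'X m n != 0.
  apply/eqP => /(congr1 (fun p : {poly R} => p`_(m + n))).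
  by apply/eqP; rewrite coef_chermite // eqxx coef0 oner_eq0.
move=> /poly_non_root[r]; rewrite -/(horner_eval r _) rmorph_chermite /=.
by rewrite /horner_eval hornerC hornerX; exists r.
Qed.

(** * The eigenfunction as a product over the blocks of the frame *)

Section Frame.
Variables (R : realType) (d p q : nat) (A B : 'M[R]_d).
Variables (f : 'I_p -> 'cV[R]_d) (lam s : 'I_p -> R).
Variables (g : 'I_q -> 'cV[R[i]]_d) (a b t : 'I_q -> R).
Variables (n : 'I_p -> nat) (n1 n2 : 'I_q -> nat).
Hypothesis lam_gt0 : forall k, 0 < lam k.
Hypothesis f_eig : forall k,
  unit_left_eigenvector A (- (lam k)%:C) (cplx (f k)).
Hypothesis a_gt0 : forall k, 0 < a k.
Hypothesis g_eig : forall k, unit_left_eigenvector A (- (a k -i* b k)) (g k).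
Hypothesis fg_on : forall i j,
  dotc (eigenframe f g i) (eigenframe f g j) = (i == j)%:R.
Hypothesis B_sym : B^T = B.
Hypothesis s_gt0 : forall k, 0 < s k.
Hypothesis t_gt0 : forall k, 0 < t k.
Hypothesis Bf : forall k, B *m f k = s k *: f k.
Hypothesis Bg : forall k, cplx B *m g k = (t k)%:C *: g k.

Local Notation "u ^J" := (map_mx Num.conj u) (at level 2, format "u ^J").
Local Notation e := (eigenframe f g).
Let Q : 'M[R]_d := 2^-1 *: (B *m B^T).
Let rho k := t k ^+ 2 / a k.
Let c k := Num.sqrt (2 * lam k / s k ^+ 2).

(** The eigenvalue of B on each vector of the eigenframe. *)
Definition frame_sigma (i : 'I_p + ('I_q + 'I_q)) : R :=
  match i with inl k => s k | inr (inl k) => t k | inr (inr k) => t k end.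

Lemma mul_frame i : cplx B *m e i = (frame_sigma i)%:C *: e i.
Proof.
case: i => [k|[k|k]] /=; rewrite ?Bg //.
  by rewrite /cplx -map_mxM Bf map_mxZ.
by rewrite -{1}(conj_cplx B) -map_mxM Bg map_mxZ /= conj_real.
Qed.

(** The eigenframe diagonalises Q, as a sesquilinear form. *)
Lemma qform_frame i j :
  qform Q (e i)^J (e j) = (frame_sigma j ^+ 2 / 2)%:C * (i == j)%:R.
Proof.
rewrite -fg_on; apply: qform_eigenvector.
rewrite /Q B_sym /cplx map_mxZ map_mxM -scalemxAl -mulmxA -!/(cplx _).
rewrite !mul_frame -scalemxAr mul_frame !scalerA -!rmorphM /=.
by congr (_%:C *: _); ring.
Qed.

Lemma Q_sym : Q^T = Q.
Proof. by rewrite /Q linearZ /= trmx_mul trmxK. Qed.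

(** The blocks are indexed by 'I_p + 'I_q: a real eigenvector is a block of its
    own, and g_k forms a block with its conjugate.  The next two functions give
    the index in the eigenframe of the first and of the second vector of a
    block; the two coincide for a real block. *)
Definition block_left (k : 'I_p + 'I_q) : 'I_p + ('I_q + 'I_q) :=
  match k with inl k => inl k | inr k => inr (inl k) end.
Definition block_right (k : 'I_p + 'I_q) : 'I_p + ('I_q + 'I_q) :=
  match k with inl k => inl k | inr k => inr (inr k) end.

(** The coefficients of the coordinate <e, x> along the first vector e of the
    block.  This is the conjugate of e, so it is also the second vector of the
    block. *)
Definition block_coord k := (e (block_left k))^J.

Lemma block_coord_right k : block_coord k = e (block_right k).
Proof. by case: k => k; rewrite /block_coord //= conj_cplx. Qed.

Lemma conj_block_coord k : (block_coord k)^J = e (block_left k).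
Proof. exact: conj_mxK. Qed.

Lemma conj_block_coord_right k : (block_coord k)^J = (e (block_right k))^J.
Proof. by rewrite block_coord_right. Qed.

Lemma linform_block k x : linform (block_coord k) (A *m x)
  = - match k with inl k => (lam k)%:C | inr k => a k -i* b k end
    * linform (block_coord k) x.
Proof. by case: k => k; apply: linform_left_eigenvector; rewrite //=. Qed.

(** The factor of [phi] given by a block. *)
Definition block (k : 'I_p + 'I_q) (x : 'cV[R]_d) : R[i] :=
  match k with
  | inl k => ((He R (n k)).[c k * dotr x (f k)])%:C
  | inr k => chermite (rho k)%:C
      ((Num.sqrt 2)%:C * linform (block_coord (inr k)) x)
      ((Num.sqrt 2)%:C * linform (block_coord (inr k))^J x) (n1 k) (n2 k)
  end.

(** The contribution of a block to the eigenvalue. *)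
Definition block_mu (k : 'I_p + 'I_q) : R[i] :=
  match k with
  | inl k => - ((n k)%:R * (lam k)%:C)
  | inr k => - ((n1 k)%:R * (a k -i* b k) + (n2 k)%:R * (a k +i* b k))
  end.

Lemma phi_block : phi f lam s g a t n n1 n2 = fun x => \prod_k block k x.
Proof.
apply/funext => x; rewrite /phi big_sumType rmorph_prod; congr (_ * _).
apply: eq_bigr => k _; rewrite J_chermite; last first.
  by rewrite mulf_neq0 ?invr_eq0 ?expf_neq0 // gt_eqF.
rewrite /block -[linform (block_coord _)^J x]conj_linform.
by rewrite /block_coord linform_conj [Num.conj (_ * _)]rmorphM /= conj_real.
Qed.

Lemma mu_block : mu lam a b n n1 n2 = \sum_k block_mu k.
Proof.
rewrite /mu big_sumType rmorph_sum -sumrN.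
congr (_ + _); apply: eq_bigr => k _ /=.
  by rewrite rmorphM rmorphN rmorph_nat mulNr.
congr (- _); rewrite -!(rmorph_nat (real_complex R)); apply/eqP.
by rewrite eq_complex /=; apply/andP; split; apply/eqP; rewrite ?natrD; ring.
Qed.

Lemma polyfun_block k : polyfun (block k).
Proof. by case: k => k; [exact: polyfun_He|exact: polyfun_chermite]. Qed.

Lemma ou_block k x :
  ornstein_uhlenbeck A Q (block k) x = block_mu k * block k x.
Proof.
case: k => k.
  apply: ou_He; first exact: Q_sym.
    have := linform_block (inl k) x; rewrite /block_coord /=.
    by rewrite conj_cplx.
  rewrite -{1}(conj_cplx (f k)) (qform_frame (inl k) (inl k)) eqxx mulr1 /=.
  rewrite -rmorphXn -rmorphM sqr_sqrtr; last first.
    by rewrite divr_ge0 ?sqr_ge0 // mulr_ge0 // ltW.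
  by congr _%:C; field; rewrite gt_eqF.
have B1 := linform_block (inr k) x.
(* u = conj g and v = g: [qform] vanishes on (u, u) and on (v, v), because g
   is orthogonal to its conjugate, and its value on (u, v) is t ^+ 2 / 2. *)
apply: ou_chermite; first exact: Q_sym.
- exact: B1.
- rewrite -!(conj_linform (block_coord _)) B1 rmorphM rmorphN /=.
  by congr (- _ * _); rewrite /Num.conj /= opprK.
- by rewrite {2}block_coord_right qform_frame /= mulr0.
- by rewrite {2}conj_block_coord conj_block_coord_right qform_frame mulr0.
- rewrite conj_block_coord qform_frame eqxx mulr1 -rmorphXn sqr_sqrtr //=.
  rewrite /rho (_ : a k -i* b k + _ = (2 * a k)%:C); last first.
    by apply/eqP; rewrite eq_complex /=; apply/andP; split; apply/eqP; ring.
  rewrite -!rmorphM /= -[2](rmorph_nat (real_complex R)) -!rmorphM /=.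
  by congr _%:C; field; rewrite gt_eqF.
Qed.

Lemma grad_block k : exists G1 G2,
  grad_span (block_coord k) (block_coord k)^J (block k) G1 G2.
Proof.
case: k => k; last by do 2 eexists; exact: grad_chermite.
rewrite {1}/block_coord /= conj_cplx; do 2 eexists; exact: grad_He.
Qed.

Lemma qform_block0 k l : k != l ->
  [/\ qform Q (block_coord k) (block_coord l) = 0,
      qform Q (block_coord k) (block_coord l)^J = 0,
      qform Q (block_coord k)^J (block_coord l) = 0
    & qform Q (block_coord k)^J (block_coord l)^J = 0].
Proof.
move=> kl.
have [ll lr rl rr] : [/\ (block_left k == block_left l) = false,
    (block_left k == block_right l) = false,
    (block_right k == block_left l) = false
  & (block_right k == block_right l) = false].
  by case: k l kl => [k|k] [l|l] kl; split=> //; exact: negbTE kl.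
split.
- by rewrite [block_coord l]block_coord_right qform_frame lr mulr0.
- by rewrite conj_block_coord qform_frame ll mulr0.
- by rewrite conj_block_coord_right [block_coord l]block_coord_right
       qform_frame rr mulr0.
- by rewrite conj_block_coord_right conj_block_coord qform_frame rl mulr0.
Qed.

Lemma carre_du_champ_block k l x : k != l ->
  carre_du_champ Q (block k) (block l) x = 0.
Proof.
move=> /qform_block0[q1 q2 q3 q4].
have [G1 [G2 Dk]] := grad_block k; have [G1' [G2' Dl]] := grad_block l.
exact: carre_du_champ0 Dk Dl q1 q2 q3 q4.
Qed.

Lemma dotc_frame_sum (z : 'I_p + ('I_q + 'I_q) -> R[i]) i :
  dotc (e i) (\sum_j z j *: e j) = z i.
Proof.
rewrite /dotc mulmx_sumr summxE (bigD1 i) //= -scalemxAr mxE.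
rewrite -/(dotc (e i) (e i)) fg_on eqxx mulr1 big1 ?addr0 // => j ji.
by rewrite -scalemxAr mxE -/(dotc (e i) (e j)) fg_on eq_sym (negPf ji) mulr0.
Qed.

(** The coordinates of a real vector can be prescribed in each block, to any
    real values. *)
Lemma exists_coord (y : 'I_p + 'I_q -> R) :
  exists x, forall k, linform (block_coord k) x = (y k)%:C.
Proof.
pose x : 'cV[R]_d := \sum_k y (inl k) *: f k
  + \sum_k y (inr k) *: (2 *: map_mx (@complex.Re R) (g k)).
exists x => k; rewrite linform_conj.
pose z i := (match i with
  inl k => y (inl k) | inr (inl k) => y (inr k) | inr (inr k) => y (inr k)
  end)%:C : R[i].
suff -> : cplx x = \sum_i z i *: e i by rewrite dotc_frame_sum; case: k.
rewrite !big_sumType /= -big_split /= /x /cplx map_mxD !raddf_sum.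
congr (_ + _); apply: eq_bigr => {}k _ /=; first by rewrite map_mxZ.
rewrite map_mxZ -scalerDr; congr (_ *: _); apply/matrixP => i j.
by rewrite !mxE addcJ rmorphM rmorph_nat.
Qed.

Lemma phi_neq0 : exists x, phi f lam s g a t n n1 n2 x != 0.
Proof.
have c_neq0 k : c k != 0.
  by rewrite sqrtr_eq0 -ltNge divr_gt0 ?exprn_gt0 // mulr_gt0.
have sqrt2_neq0 : Num.sqrt 2 != 0 :> R by rewrite sqrtr_eq0 -ltNge.
have /choice[y1 Hy1] k : exists r, (He R (n k)).[c k * r] != 0.
  have [r Hr] := poly_non_root (He_neq0 R (n k)).
  by exists ((c k)^-1 * r); rewrite mulVKf.
have /choice[y2 Hy2] k : exists r,
    chermite (rho k) (Num.sqrt 2 * r) (Num.sqrt 2 * r) (n1 k) (n2 k) != 0.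
  have [r Hr] := chermite_neq0 (rho k) (n1 k) (n2 k).
  by exists ((Num.sqrt 2)^-1 * r); rewrite mulVKf.
have [x Hx] := exists_coord
  (fun k => match k with inl k => y1 k | inr k => y2 k end).
exists x; rewrite phi_block; apply/prodf_neq0 => -[k|k] _ /=.
  have := Hx (inl k); rewrite /block_coord /= conj_cplx -dotr_linform.
  move=> /complexI ->.
  by rewrite fmorph_eq0.
rewrite -(conj_linform (block_coord _)) Hx conj_real -rmorphM.
by rewrite -real_complex_chermite fmorph_eq0.
Qed.

Lemma ou_eigenfunction_phi :
  ou_eigenfunction A Q (mu lam a b n n1 n2) (phi f lam s g a t n n1 n2).
Proof.
have Pphi : polyfun (phi f lam s g a t n n1 n2).
  by rewrite phi_block; apply: polyfun_prod => k; exact: polyfun_block.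
split=> [i x|i j x||x].
- exact: polyfun_has_partial.
- by apply: polyfun_has_partial; exact: polyfun_partial.
- exact: phi_neq0.
rewrite phi_block mu_block.
apply: ou_prod; [exact: Q_sym|exact: index_enum_uniq|exact: polyfun_block| |].
  by move=> k; exact: ou_block.
by move=> k l; exact: carre_du_champ_block.
Qed.

End Frame.

Unset Implicit Arguments.
Set Strict Implicit.

Theorem mainTheorem1 (R : realType) (d l l' : nat)
    (A B Q : 'M[R]_d)
    (f : 'I_l' -> 'cV[R]_d) (lam s : 'I_l' -> R)
    (g : 'I_(l - l') -> 'cV[R[i]]_d) (a b t : 'I_(l - l') -> R)
    (hl : (l' <= l)%N) (hd : (l' + 2 * (l - l') = d)%N)
    (A_normal : A *m A^T = A^T *m A)
    (A_stable : forall z : R[i], eigenvalue (cplx A) z -> complex.Re z < 0)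
    (A_count : eigenvalue_count A l' (l - l'))
    (lam_gt0 : forall k, 0 < lam k)
    (f_eig : forall k,
       unit_left_eigenvector A (- (lam k)%:C) (cplx (f k)))
    (a_gt0 : forall k, 0 < a k)
    (b_neq0 : forall k, b k != 0)
    (g_eig : forall k,
       unit_left_eigenvector A (- (a k -i* b k)) (g k))
    (fg_basis : orthonormal_basis (eigenframe f g))
    (B_sym : B^T = B)
    (s_gt0 : forall k, 0 < s k)
    (t_gt0 : forall k, 0 < t k)
    (Bf : forall k, B *m f k = s k *: f k)
    (Bg : forall k, cplx B *m g k = (t k)%:C *: g k)
    (hQ : Q = 2^-1 *: (B *m B^T))
    (n : 'I_l' -> nat) (n1 n2 : 'I_(l - l') -> nat) :
  ou_eigenfunction A Q (mu lam a b n n1 n2) (phi f lam s g a t n n1 n2).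
Proof.
subst Q; apply: ou_eigenfunction_phi => //.
by case: fg_basis.
Qed.
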